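(* Let $K$ be a number field, $A=\mathfrak o_K$, and let $C(X)=X^2-sX+\pi\in A[X]$ with discriminant $\Delta_C=s^2-4\pi$ not a square in $A$, so that the splitting field $E$ of $C$ over $K$ is a quadratic extension with Galois group $G=\langle\tau\rangle\simeq\mathbb Z/2\mathbb Z$. Then for every sequence $(U_n)_{n\in\mathbb N}$ of elements of $A$ with $U_{n+2}=sU_{n+1}-\pi U_n$ for all $n$: - if $\mathcal P\in\mathrm{Split}(E/K)$, then $U_{N(\mathcal P)}\equiv U_1\pmod{\mathcal P}$; - if $\mathcal P\in\mathbb P(E/K,\tau)$, then $U_{N(\mathcal P)}\equiv sU_0-U_1\pmod{\mathcal P}$.
   Context: $B=\mathfrak o_E$. For a nonzero prime ideal $\mathcal P$ of $A$, $N(\mathcal P)=|A/\mathcal P|$. For $\sigma\in G$, $\mathbb P(E/K,\sigma)$ is the set of nonzero prime ideals $\mathcal P$ of $A$ with $\Delta_C\notin\mathcal P$ such that some prime $Q$ of $B$ above $\mathcal P$ has Frobenius $\sigma$, i.e. $\sigma(x)\equiv x^{N(\mathcal P)}\pmod Q$ for all $x\in B$; $\mathrm{Split}(E/K)=\mathbb P(E/K,\mathrm{Id})$. *)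

(* Defs.v *)
From HB Require Import structures.
From mathcomp Require Import all_boot all_order all_algebra all_fingroup.
From mathcomp Require Import all_solvable all_field ring_quotient.
From mathcomp Require Import finmap boolp classical_sets cardinality.

Set Implicit Arguments.
Unset Strict Implicit.
Unset Printing Implicit Defensive.

Import GRing.Theory.
Local Open Scope ring_scope.

Definition int_closure (F : fieldType) : {pred F} :=
  fun x => `[< integralOver (intr : int -> F) x >].

Fact int_closure_subring (F : fieldType) : subring_closed (@int_closure F).
Proof.
split=> [|x y /asboolP ix /asboolP iy|x y /asboolP ix /asboolP iy]; apply/asboolP.
- exact: integral1.
- exact: integral_sub.
- exact: integral_mul.
Qed.

HB.instance Definition _ (F : fieldType) :=
  GRing.isSubringClosed.Build F (@int_closure F) (@int_closure_subring F).

(* The ring of integers of F: the integral closure of Z in F. *)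
Record roi (F : fieldType) := Roi {
  roi_val :> F;
  roi_valP : roi_val \in @int_closure F
}.

HB.instance Definition _ (F : fieldType) := [isSub for @roi_val F].
HB.instance Definition _ (F : fieldType) := [Choice of roi F by <:].
HB.instance Definition _ (F : fieldType) :=
  [SubChoice_isSubComNzRing of roi F by <:].

Fact roi_map_subproof (F1 F2 : fieldType) (f : {rmorphism F1 -> F2}) (x : roi F1) :
  f (val x) \in @int_closure F2.
Proof.
have /asboolP/(integral_rmorph f) fx := valP x; apply/asboolP.
case: fx => p mp rp; exists p => //; congr (root _ _): rp.
by apply: eq_map_poly => z /=; rewrite rmorph_int.
Qed.

Definition roi_map (F1 F2 : fieldType) (f : {rmorphism F1 -> F2}) (x : roi F1) :
  roi F2 := Roi (roi_map_subproof f x).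

Definition roi_incl (K : fieldType) (E : fieldExtType K) : roi K -> roi E :=
  roi_map (in_alg E).

Definition roi_gal (K : fieldType) (E : splittingFieldType K)
  (sigma : gal_of {:E}) : roi E -> roi E := roi_map sigma.

(* Equal to 0 when R / P is infinite, which never happens for a nonzero prime P
   of the ring of integers of a number field. *)
Definition ideal_norm (R : comNzRingType) (P : prime_idealr R) : nat :=
  #|` fset_set [set: {ideal_quot P}] |.

Definition nonzero_ideal (R : comNzRingType) (P : prime_idealr R) : Prop :=
  exists2 x : R, x \in P & x != 0.

(* frob_primes Delta sigma is P(E/K, sigma): the paper removes the primes containing
   the discriminant Delta of the quadratic polynomial defining E. *)
Section FrobeniusPrimes.
Variables (K : fieldExtType rat) (E : splittingFieldType K).

Definition lies_above (Q : prime_idealr (roi E)) (P : prime_idealr (roi K)) : Prop :=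
  forall x : roi K, (roi_incl E x \in Q) = (x \in P).

Definition has_frobenius (Q : prime_idealr (roi E)) (P : prime_idealr (roi K))
    (sigma : gal_of {:E}) : Prop :=
  forall x : roi E, roi_gal sigma x - x ^+ ideal_norm P \in Q.

Definition frob_primes (Delta : roi K) (sigma : gal_of {:E})
    (P : prime_idealr (roi K)) : Prop :=
  [/\ nonzero_ideal P, Delta \notin P &
    exists2 Q : prime_idealr (roi E), lies_above Q P & has_frobenius Q P sigma].

Definition split_primes (Delta : roi K) : prime_idealr (roi K) -> Prop :=
  frob_primes Delta 1%g.

End FrobeniusPrimes.

Definition quad_poly (R : nzRingType) (s p : R) : {poly R} :=
  'X^2 - s *: 'X + p%:P.

Definition quad_disc (R : nzRingType) (s p : R) : R := s ^+ 2 - 4%:R * p.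

(* Main.v *)
(** Let [a], [b] be the roots of [C] in [E]; both are integral.  The Binet
    identity [(a - b) U_n = a^n (U_1 - b U_0) - b^n (U_1 - a U_0)] holds without
    any division.  Modulo a prime [Q] above [P], raising to the power [N(P)] acts
    on [a] and [b] as the Frobenius does: it fixes both roots if the Frobenius is
    trivial and exchanges them if it is [tau].  Since [(a - b)^2] is the
    discriminant, which is not in [P], the factor [a - b] cancels modulo [Q]. *)
Require Import Defs.
From HB Require Import structures.
From mathcomp Require Import all_boot all_order all_algebra all_fingroup.
From mathcomp Require Import all_solvable all_field ring_quotient.
From mathcomp Require Import boolp ring.

Import GRing.Theory.
Local Open Scope ring_scope.

Fact roi_map_zmod_morphism (F1 F2 : fieldType) (f : {rmorphism F1 -> F2}) :
  zmod_morphism (roi_map f).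
Proof. by move=> x y; apply: val_inj; rewrite /= !rmorphB. Qed.

Fact roi_map_monoid_morphism (F1 F2 : fieldType) (f : {rmorphism F1 -> F2}) :
  monoid_morphism (roi_map f).
Proof.
by split=> [|x y]; apply: val_inj; rewrite /= ?rmorph1 ?rmorphM.
Qed.

HB.instance Definition _ (F1 F2 : fieldType) (f : {rmorphism F1 -> F2}) :=
  GRing.isZmodMorphism.Build (roi F1) (roi F2) (roi_map f)
    (@roi_map_zmod_morphism F1 F2 f).

HB.instance Definition _ (F1 F2 : fieldType) (f : {rmorphism F1 -> F2}) :=
  GRing.isMonoidMorphism.Build (roi F1) (roi F2) (roi_map f)
    (@roi_map_monoid_morphism F1 F2 f).

HB.instance Definition _ (K : fieldType) (E : fieldExtType K) :=
  GRing.RMorphism.copy (@roi_incl K E) (roi_map (in_alg E)).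

Lemma int_closure_root {F : fieldType} {q : {poly F}} {x : F} :
  q \is monic -> root q x -> q \is a polyOver (@int_closure F) ->
  x \in @int_closure F.
Proof.
move=> q_monic qx0 /allP q_int; apply/asboolP.
by apply: integral_root_monic q_monic qx0 _ => c /q_int/asboolP.
Qed.

(** [x] is a root of the monic polynomial ['X^2 - x^2], whose coefficients are integral. *)
Lemma int_closure_sqr (F : fieldType) (x : F) :
  x ^+ 2 \in @int_closure F -> x \in @int_closure F.
Proof.
move=> x2_int; apply: (int_closure_root (monicXnsubC (x ^+ 2) (isT : 0 < 2)%N)).
  by rewrite rootE !hornerE subrr.
by rewrite rpredB ?rpredX ?polyOverX ?polyOverC.
Qed.

Lemma binet (R : comNzRingType) (a b : R) (U : nat -> R) :
    (forall n, U n.+2 = (a + b) * U n.+1 - a * b * U n) ->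
  forall n, (a - b) * U n = a ^+ n * (U 1 - b * U 0) - b ^+ n * (U 1 - a * U 0).
Proof.
(* The recurrence has order two, so the induction carries two consecutive indices. *)
move=> UE n; suff: (a - b) * U n = a ^+ n * (U 1 - b * U 0) -
    b ^+ n * (U 1 - a * U 0) /\ (a - b) * U n.+1 =
    a ^+ n.+1 * (U 1 - b * U 0) - b ^+ n.+1 * (U 1 - a * U 0) by case.
elim: n => [|n [IH0 IH1]]; first by split; ring.
split=> //; rewrite UE.
have -> : (a - b) * ((a + b) * U n.+1 - a * b * U n) =
    (a + b) * ((a - b) * U n.+1) - a * b * ((a - b) * U n) by ring.
by rewrite IH0 IH1 !exprS; ring.
Qed.

(* In the application [N = ideal_norm P] and [(a', b')] is the image of [(a, b)]
   under the Frobenius, so that [a' = a, v = U 1] or [a' = b, v = s U 0 - U 1]. *)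
Lemma binet_mod (R : comNzRingType) (Q : prime_idealr R) (a b a' b' v : R)
    (U : nat -> R) (N : nat) :
    (forall n, U n.+2 = (a + b) * U n.+1 - a * b * U n) ->
    a - b \notin Q -> a' - a ^+ N \in Q -> b' - b ^+ N \in Q ->
    (a - b) * v = a' * (U 1 - b * U 0) - b' * (U 1 - a * U 0) ->
  U N - v \in Q.
Proof.
move=> UE abQ aQ bQ vE.
suff: (a - b) * (U N - v) \in Q by rewrite prime_idealrM (negbTE abQ).
have -> : (a - b) * (U N - v) =
    (U 1 - a * U 0) * (b' - b ^+ N) - (U 1 - b * U 0) * (a' - a ^+ N).
  by rewrite mulrBr vE binet //; ring.
by rewrite rpredB // idealMr.
Qed.

Lemma quad_polyE (R : comNzRingType) (a b : R) :
  ('X - a%:P) * ('X - b%:P) = quad_poly (a + b) (a * b).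
Proof. by rewrite /quad_poly -mul_polyC polyCD polyCM; ring. Qed.

Lemma size_quad_poly (R : nzRingType) (s p : R) : size (quad_poly s p) = 3%N.
Proof.
rewrite /quad_poly -addrA size_polyDl size_polyXn //.
rewrite ltnS (leq_trans (size_polyD _ _)) // geq_max size_polyN.
rewrite (leq_trans (size_scale_leq _ _)) ?size_polyX //=.
by rewrite (leq_trans (size_polyC_leq1 _)).
Qed.

Lemma monic_quad_poly (R : nzRingType) (s p : R) : quad_poly s p \is monic.
Proof.
by rewrite monicE lead_coefE size_quad_poly !coefE /= mulr0 subr0 addr0.
Qed.

Lemma map_quad_poly (R S : nzRingType) (f : {rmorphism R -> S}) (s p : R) :
  map_poly f (quad_poly s p) = quad_poly (f s) (f p).
Proof.
by rewrite rmorphD rmorphB /= map_polyC map_polyZ /= map_polyXn map_polyX.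
Qed.

Lemma quad_poly_inj (R : nzRingType) (s p s' p' : R) :
  quad_poly s p = quad_poly s' p' -> s = s' /\ p = p'.
Proof.
move=> /polyP eq_sp; have := (eq_sp 1, eq_sp 0); rewrite !coefE /=.
by rewrite !mulr1 !mulr0 !sub0r !oppr0 !addr0 !add0r => -[/oppr_inj].
Qed.

(** Both sides are monic, so being associated means being equal; the degree then gives two roots and
    the coefficients give their sum and product. *)
Lemma splits_quad (L : fieldType) (s p : L) (rs : seq L) :
    quad_poly s p %= \prod_(z <- rs) ('X - z%:P) ->
  exists a b, [/\ rs = [:: a; b], s = a + b & p = a * b].
Proof.
rewrite eqp_monic ?monic_quad_poly ?monic_prod_XsubC // => /eqP rsE.
have : size rs == 2%N.
  by rewrite -eqSS -(size_prod_XsubC rs id) -rsE size_quad_poly.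
case: rs rsE => [|a [|b []]] //; rewrite !big_cons big_nil mulr1 quad_polyE.
by move=> /quad_poly_inj[sE pE] _; exists a, b.
Qed.

Lemma quad_splitting (F : fieldType) (L : splittingFieldType F) (a b : L) :
    a != b -> a + b \in 1%VS -> a * b \in 1%VS -> a \notin 1%VS ->
    <<1 & [:: a; b]>>%VS = {:L}%VS ->
  [/\ galois 1 {:L}, \dim {:L} = 2%N &
      forall tau : gal_of {:L}, 'Gal({:L} / 1)%g = <[tau]>%g -> tau a = b].
Proof.
move=> neq_ab s1 p1 a1 LE; set q := quad_poly (a + b) (a * b).
have q1 : q \is a polyOver 1%VS.
  by rewrite rpredD ?rpredB ?polyOverZ ?polyOverC ?rpredX ?polyOverX.
have galL : galois 1 {:L}.
  apply/splitting_galoisField; exists q; rewrite q1; split=> //.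
    have := separable_prod_XsubC [:: a; b].
    by rewrite !big_cons big_nil mulr1 quad_polyE /= inE neq_ab => ->.
  by exists [:: a; b]; rewrite ?LE // !big_cons big_nil mulr1 quad_polyE eqpxx.
split=> // [|tau galE].
  (* Since [b = (a + b) - a], the root [a] alone generates [L]. Its degree is not 1 by [a1], and at
     most 2 because its minimal polynomial divides [q]. *)
  have {}LE : <<1; a>>%VS = {:L}%VS.
    rewrite -LE adjoin_cons adjoin_seq1; apply/esym/Fadjoin_idP.
    have -> : b = a + b - a by ring.
    by rewrite rpredB ?memv_adjoin ?(subvP (subv_adjoin _ _)).
  have := adjoin_degreeE 1%AS a; rewrite LE dimv1 divn1 => <-.
  apply/eqP; rewrite eqn_leq ltn_neqAle eq_sym adjoin_deg_eq1 a1 /=.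
  rewrite andbT -ltnS -size_minPoly -(size_quad_poly _ (a + b) (a * b)).
  rewrite dvdp_leq -?size_poly_eq0 ?size_quad_poly // minPoly_dvdp //.
  by rewrite -quad_polyE rootM root_XsubC eqxx.
(* [tau] fixes the coefficients of [q], hence permutes its roots. *)
have : (tau a - a) * (tau a - b) = 0.
  have tau1 x : x \in 1%VS -> tau x = x.
    by apply: fixed_gal; rewrite ?sub1v // galE cycle_id.
  have -> : (tau a - a) * (tau a - b) = tau a ^+ 2 - (a + b) * tau a + a * b.
    by ring.
  rewrite -{1}(tau1 _ s1) -{1}(tau1 _ p1) -rmorphXn -rmorphM -rmorphB -rmorphD.
  by rewrite (_ : _ + _ = 0) ?rmorph0 //; ring.
move/eqP; rewrite mulf_eq0 !subr_eq0 => /orP[/eqP tau_a|/eqP //].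
(* By the Galois correspondence a generator of the Galois group fixes only the base field, so
   [tau a = a] would contradict [a1]. *)
have fixE : fixedField [set tau] = 1%VS.
  rewrite -(galois_fixedField (fixedField_galois [set tau])) gal_generated.
  by rewrite -/(cycle tau) -galE; apply/galois_fixedField.
case/negP: a1; rewrite -fixE; apply/fixedFieldP; rewrite ?memvf // => x.
by rewrite inE => /eqP->.
Qed.

(** If [a] were some [k] in [K], then [s - 2k], which is [b - a], would be a square root of the
    discriminant in [K]. It is integral because its square is, so the discriminant would be a square
    in [roi K]. *)
Lemma notin_base_quad (K : fieldType) (L : fieldExtType K) (s p : roi K)
    (a b : L) :
    ~ (exists d : roi K, quad_disc s p = d ^+ 2) ->
    (val s)%:A = a + b -> (val p)%:A = a * b -> a \notin 1%VS.
Proof.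
move=> nsq sE pE; apply/negP=> /vlineP[k aE]; apply: nsq.
have dE : (val s - 2%:R * k) ^+ 2 = val (quad_disc s p).
  apply: (fmorph_inj (in_alg L)).
  rewrite /quad_disc !(rmorphB, rmorphM, rmorphXn, rmorph_nat) /=.
  by rewrite sE pE -aE; ring.
have d_int : val s - 2%:R * k \in @int_closure K.
  by apply: int_closure_sqr; rewrite dE (valP (quad_disc s p)).
by exists (Roi d_int); apply: val_inj; rewrite -dE rmorphXn.
Qed.

Theorem theorem18 (K : fieldExtType rat) (s p : roi K) (E : splittingFieldType K)
    (Delta_nonsquare : ~ exists d : roi K, quad_disc s p = d ^+ 2)
    (E_splits : splittingFieldFor 1
       (map_poly (in_alg E \o val) (quad_poly s p)) {:E}) :
  [/\ \dim {:E} = 2%N,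
      'Gal({:E} / 1) \isog Zp 2 &
      forall tau : gal_of {:E}, 'Gal({:E} / 1)%g = <[tau]>%g ->
      forall U : nat -> roi K,
        (forall n : nat, U n.+2 = s * U n.+1 - p * U n) ->
        (forall P : prime_idealr (roi K), split_primes E (quad_disc s p) P ->
           U (ideal_norm P) - U 1%N \in P) /\
        (forall P : prime_idealr (roi K), frob_primes (quad_disc s p) tau P ->
           U (ideal_norm P) - (s * U 0%N - U 1%N) \in P)].
Proof.
case: E_splits => rs; rewrite map_quad_poly.
case/splits_quad=> a [b [-> /= sE pE]] EE.
have a1 := notin_base_quad _ _ _ _ _ _ Delta_nonsquare sE pE.
(* A double root would make the discriminant 0, which is the square of 0. *)
have neq_ab : a != b.
  apply/eqP=> eq_ab; apply: Delta_nonsquare; exists 0; apply: val_inj.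
  apply: (fmorph_inj (in_alg E)); rewrite /quad_disc.
  rewrite !(rmorph0, rmorphB, rmorphM, rmorphXn, rmorph_nat) /=.
  by rewrite sE pE eq_ab; ring.
have s1 : a + b \in 1%VS by rewrite -sE rpredZ ?mem1v.
have p1 : a * b \in 1%VS by rewrite -pE rpredZ ?mem1v.
have [galE dimE tauE] := quad_splitting _ _ _ _ neq_ab s1 p1 a1 EE.
have cardG : #|'Gal({:E} / 1)%g| = 2%N by rewrite -galois_dim // dimv1 divn1.
split=> // [|tau /tauE tau_a U UE].
  by rewrite isog_cyclic_card !prime_cyclic ?card_Zp ?cardG.
have q_int : quad_poly (a + b) (a * b) \is a polyOver (@int_closure E).
  have /= := (valP (roi_incl E s), valP (roi_incl E p)); rewrite sE pE => -[si pi].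
  by rewrite rpredD ?rpredB ?polyOverZ ?polyOverC ?rpredX ?polyOverX.
have rootE x : root (quad_poly (a + b) (a * b)) x = (x == a) || (x == b).
  by rewrite -quad_polyE rootM !root_XsubC.
have qa : root (quad_poly (a + b) (a * b)) a by rewrite rootE eqxx.
have qb : root (quad_poly (a + b) (a * b)) b by rewrite rootE eqxx orbT.
pose ra := Roi (int_closure_root (monic_quad_poly _ _ _) qa q_int).
pose rb := Roi (int_closure_root (monic_quad_poly _ _ _) qb q_int).
have rsE : roi_incl E s = ra + rb by apply: val_inj.
have rpE : roi_incl E p = ra * rb by apply: val_inj.
(* Both congruences at once: [v] is the predicted residue, and membership in [P] is tested in the
   prime [Q] above it. *)
have key sigma P ra' rb' v : frob_primes (quad_disc s p) sigma P ->
    roi_gal sigma ra = ra' -> roi_gal sigma rb = rb' ->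
    (ra - rb) * roi_incl E v = ra' * (roi_incl E (U 1) - rb * roi_incl E (U 0))
      - rb' * (roi_incl E (U 1) - ra * roi_incl E (U 0)) ->
    U (ideal_norm P) - v \in P.
  case=> _ DP [Q QP frobQ] <- <- vE; rewrite -QP rmorphB.
  apply: (binet_mod _ Q ra rb _ _ _ (roi_incl E \o U)) vE => //=.
  - by move=> n; rewrite UE -rsE -rpE rmorphB !rmorphM.
  - apply: contra DP => abQ; rewrite -QP.
    rewrite /quad_disc rmorphB rmorphXn rmorphM rmorph_nat /= rsE rpE.
    have -> : (ra + rb) ^+ 2 - 4%:R * (ra * rb) = (ra - rb) * (ra - rb) by ring.
    by rewrite idealMr.
(* [tau] fixes [a + b], which comes from [s], and sends [a] to [b]. *)
have tau_b : tau b = a.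
  have -> : b = a + b - a by ring.
  rewrite rmorphB /= tau_a -sE linearZ rmorph1 /= sE.
  by ring.
split=> P frobP.
- by apply: (key _ _ ra rb _ frobP); [apply/val_inj/gal_id.. | ring].
(* With the roots exchanged, the right-hand side factors as [(a - b) * ((a + b) * U 0 - U 1)]. *)
- apply: (key _ _ rb ra _ frobP); [exact: val_inj.. |].
  by rewrite rmorphB rmorphM /= rsE; ring.
Qed.
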